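(* Let $C_3$ be the cycle with vertex set $V=\{0,1,2\}$, any two distinct vertices being adjacent, with edge weight $w\equiv1$. Let $m_0:V\to\mathbb{R}_+$ and let $m\in C^\infty([0,T)\times V,\mathbb{R}_+)$ be a solution to the Bakry-Émery Ricci flow (with $n=\infty$) $$\partial_t m(t,i)=-\mathrm{Ric}_{m(t,\cdot)}(i),\qquad m(0,i)=m_0(i),\qquad i\in V.$$ Then $\max_{x\in V}m(t,x)$ is decreasing in $t$. Moreover, $T\le\max_{x\in V}(m_0(x))^2$.
   Context: $\mathbb{R}_+=(0,\infty)$. Write $y\sim x$ if $\{x,y\}$ is an edge. For a vertex weight $m:V\to\mathbb{R}_+$ (edge weight $\equiv1$) and $f,g:V\to\mathbb{R}$ define $$\Delta f(x)=\frac{1}{m(x)}\sum_{y\sim x}(f(y)-f(x)),\qquad \Gamma(f,g)=\tfrac12\big(\Delta(fg)-f\Delta g-g\Delta f\big),$$ $$\Gamma(f)=\Gamma(f,f),\qquad \Gamma_2(f)=\tfrac12\Delta\Gamma(f)-\Gamma(\Delta f,f).$$ The ($\infty$-dimensional) Bakry-Émery curvature $\mathrm{Ric}_m(x)$ is the maximal $K\in\mathbb{R}$ such that $\Gamma_2(f)(x)\ge K\,\Gamma(f)(x)$ for all $f:V\to\mathbb{R}$. $C^\infty([0,T)\times V,\mathbb{R}_+)$ denotes functions $m:[0,T)\times V\to\mathbb{R}_+$ such that $t\mapsto m(t,x)$ is smooth for every $x\in V$. *)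

(* Defs.v *)
From HB Require Import structures.
From mathcomp Require Import all_boot all_order all_algebra.
From mathcomp Require Import all_classical all_reals all_analysis.
Set Implicit Arguments.
Unset Strict Implicit.
Unset Printing Implicit Defensive.
Import Order.TTheory GRing.Theory Num.Theory.
Import numFieldNormedType.Exports.
Local Open Scope classical_set_scope.
Local Open Scope ring_scope.

Section BakryEmery.
Context {R : realType} {V : finType}.
Variable adj : rel V.
Implicit Types (m f g : V -> R) (x : V) (K : R).

Definition laplacian m f : V -> R :=
  fun x => (m x)^-1 * \sum_(y | adj y x) (f y - f x).

Definition carre_du_champ m f g : V -> R := fun x =>
  2^-1 * (laplacian m (fun y => f y * g y) x
          - f x * laplacian m g x - g x * laplacian m f x).

Definition Gamma2 m f : V -> R := fun x =>
  2^-1 * laplacian m (carre_du_champ m f f) x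
  - carre_du_champ m (laplacian m f) f x.

Definition curvature_ge m x K : Prop :=
  forall f, K * carre_du_champ m f f x <= Gamma2 m f x.

(* A relation rather than a function, so that no junk value is needed at
   vertices without a maximal K (isolated ones). *)
Definition is_Ric m x K : Prop :=
  curvature_ge m x K /\ forall K', curvature_ge m x K' -> K' <= K.

End BakryEmery.

Section TimeDerivative.
Context {R : realType}.
Implicit Types (A : set R) (u : R -> R) (t l : R).

(* For A = [0, T[ this is the right derivative at 0 and the ordinary derivative
   elsewhere; the values of u outside A are irrelevant. *)
Definition is_derive_within A u t l : Prop :=
  (u s - u t) / (s - t) @[s --> within A t^'] --> l.

(* du k is the k-th derivative of u on A. *)
Definition smooth_on A u : Prop :=
  exists du : nat -> R -> R,
    (forall t, A t -> du 0%N t = u t) /\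
    (forall k t, A t -> is_derive_within A (du k) t (du k.+1 t)).

End TimeDerivative.

(* [0, T[ with T possibly +oo *)
Definition time_domain {R : realType} (T : \bar R) : set R :=
  [set t | 0 <= t /\ (t%:E < T)%E].

Section Flow.
Context {R : realType} {V : finType}.

(* C^oo([0, T[ x V, R_+) *)
Definition smooth_positive (T : \bar R) (m : R -> V -> R) : Prop :=
  (forall t x, time_domain T t -> 0 < m t x) /\
  (forall x, smooth_on (time_domain T) (m ^~ x)).

Definition BE_Ricci_flow (adj : rel V) (T : \bar R) (m0 : V -> R)
    (m : R -> V -> R) : Prop :=
  (forall t x, time_domain T t ->
     exists2 K : R, is_Ric adj (m t) x K &
       is_derive_within (time_domain T) (m ^~ x) t (- K)) /\
  (forall x, m 0 x = m0 x).

End Flow.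

Definition C3 : rel 'I_3 := fun x y => x != y.

(* The default value of the big operator is itself one of the values of g. *)
Definition max3 {R : realType} (g : 'I_3 -> R) : R :=
  \big[Num.max/g ord0]_(x < 3) g x.

(* Main.v *)
(* Let x maximize m, let y, z be the other two vertices, and put p = 1/m(x),
   q = 1/m(y), r = 1/m(z), so that p <= q and p <= r.  At x,
   Gamma2(f) - p Gamma(f) is a nonnegative combination of squares, so
   Ric_m(x) >= 1/m(x).  Hence (m^2 + t)' <= -1 at every vertex realizing
   max m, so max m^2 + t never increases: on [s, t], the largest value of
   m_i^2 + t over all vertices and times cannot be reached at a time after s.
   This gives the strict decrease of max m, and max m > 0 bounds T. *)
Require Import Defs.
From mathcomp Require Import all_boot all_order all_algebra.
From mathcomp Require Import all_classical all_reals all_analysis.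
From mathcomp Require Import ring lra.
Import Order.TTheory GRing.Theory Num.Theory.
Import numFieldNormedType.Exports.
Local Open Scope ring_scope.

Lemma C3_other_vertices (x : 'I_3) : exists y z : 'I_3, uniq [:: x; y; z].
Proof.
by case: x => [[|[|[|n]]] hn] //;
  [exists (inord 1), (inord 2) | exists (inord 0), (inord 2)
  | exists (inord 0), (inord 1)]; rewrite /= !inE -!val_eqE /= !inordK.
Qed.

(** Three distinct vertices exhaust ['I_3]. The labelling is left arbitrary so that the formula
    applies at each of the three vertices. *)
Lemma laplacian_C3 {R : realType} (m f : 'I_3 -> R) {x y z : 'I_3} :
  uniq [:: x; y; z] ->
  laplacian C3 m f x = (m x)^-1 * ((f y - f x) + (f z - f x)).
Proof.
move=> u; have e : perm_eq (index_enum 'I_3) [:: x; y; z].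
  rewrite perm_sym; apply: uniq_perm; rewrite ?index_enum_uniq//.
  have [||_ //] := uniq_min_size u (s2 := index_enum 'I_3).
    by move=> v _; rewrite mem_index_enum.
  by rewrite /index_enum -enumT size_enum_ord.
move: u; rewrite /= !inE negb_or andbT => /andP[/andP[xy xz] yz].
rewrite /laplacian (perm_big _ e)/= !big_cons big_nil /C3 eqxx/=.
by rewrite ![_ == x]eq_sym xy xz/= addr0.
Qed.

Lemma curvature_ge_C3_argmax {R : realType} (m : 'I_3 -> R) (x : 'I_3) :
  (forall y, 0 < m y) -> (forall y, m y <= m x) ->
  curvature_ge C3 m x (m x)^-1.
Proof.
move=> m0 mx f; have [y [z u]] := C3_other_vertices x.
have uy : uniq [:: y; x; z].
  move: u; rewrite /= !inE [y == x]eq_sym.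
  by case: (x == y) (x == z) (y == z) => [] [] [].
have uz : uniq [:: z; x; y].
  move: u; rewrite /= !inE [z == x]eq_sym [z == y]eq_sym.
  by case: (x == y) (x == z) (y == z) => [] [] [].
have hq : (m x)^-1 <= (m y)^-1 by rewrite lef_pV2 ?posrE.
have hr : (m x)^-1 <= (m z)^-1 by rewrite lef_pV2 ?posrE.
have hp : 0 < (m x)^-1 by rewrite invr_gt0.
rewrite /Gamma2 /carre_du_champ.
rewrite !(laplacian_C3 _ _ u) !(laplacian_C3 _ _ uy) !(laplacian_C3 _ _ uz).
move: (m x)^-1 (m y)^-1 (m z)^-1 (f x) (f y) (f z) hp hq hr => p q r c a' b'.
set a := a' - c; set b := b' - c => hp hq hr.
rewrite -subr_ge0; set D := (X in 0 <= X).
(* [D] is [Gamma2 - p * Gamma] at [x], and [a], [b] are the increments of [f] from [x] to [y] and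
   [z]. The terms [b - 2 * a] and [a - 2 * b] are the Laplacians at [y] and [z] without their
   weights [q] and [r]; maximality of [m x] makes [q - p] and [r - p] nonnegative. *)
have -> : D = p / 2 * (p * ((a - b) ^+ 2 + 3 / 2 * (a ^+ 2 + b ^+ 2))
    + (q - p) * ((b - 2 * a) ^+ 2 / 2 + a ^+ 2)
    + (r - p) * ((a - 2 * b) ^+ 2 / 2 + b ^+ 2)).
  by rewrite /D /a /b; field.
have sq s t : 0 <= s ^+ 2 / 2 + t ^+ 2 :> R.
  by rewrite addr_ge0 ?divr_ge0 ?sqr_ge0.
have sq' : 0 <= (a - b) ^+ 2 + 3 / 2 * (a ^+ 2 + b ^+ 2).
  by rewrite addr_ge0 ?sqr_ge0// mulr_ge0 ?divr_ge0// addr_ge0 ?sqr_ge0.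
apply: mulr_ge0; first by rewrite divr_ge0 ?ltW.
apply: addr_ge0; last by rewrite mulr_ge0 ?subr_ge0.
by apply: addr_ge0; rewrite mulr_ge0 ?subr_ge0// ltW.
Qed.

Lemma le_max3 {R : realType} (g : 'I_3 -> R) (i : 'I_3) : g i <= max3 g.
Proof. exact: le_bigmax. Qed.

Lemma max3_attained {R : realType} (g : 'I_3 -> R) : exists i, max3 g = g i.
Proof.
case: (@arg_maxP _ _ _ ord0 predT g isT) => i _ gi; exists i.
apply/eqP; rewrite eq_le le_max3 andbT.
by apply: bigmax_le => [|j _]; exact: gi.
Qed.

Section DeriveWithin.
Context {R : realType}.
Local Open Scope classical_set_scope.
Local Open Scope ring_scope.
Implicit Types (A : set R) (u : R -> R) (c l : R).

(** Near [c] the difference quotient is within 1 of [l], so the increment of [u] is at most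
    [(|l| + 1) * |s - c|]. *)
Lemma is_derive_within_continuous {A u c l} :
  is_derive_within A u c l -> u s @[s --> within A (nbhs c)] --> u c.
Proof.
move=> /cvgrPdist_lt/(_ _ ltr01); rewrite !near_withinE => hq.
apply/cvgrPdist_lt => e e0; rewrite near_withinE.
have l1 : 0 < `|l| + 1 by rewrite ltr_wpDl.
near=> s => As; have [->|sc] := eqVneq s c; first by rewrite subrr normr0.
have : `|l - (u s - u c) / (s - c)| < 1.
  by move: As; move: sc; near: s.
have : `|s - c| < e / (`|l| + 1).
  rewrite distrC; near: s.
  by apply: cvgr_dist_lt; [exact: cvg_id | rewrite divr_gt0].
set q := _ / (s - c) => sce lq.
have -> : u c - u s = - (q * (s - c)) by rewrite /q divfK ?subr_eq0// opprB.
have ql : `|q| <= `|l| + 1.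
  rewrite -lerBlDl; apply: le_trans (ltW lq); rewrite distrC; exact: lerB_dist.
rewrite normrN normrM (le_lt_trans (ler_wpM2r _ ql))//.
by rewrite mulrC -ltr_pdivlMr.
Unshelve. all: by end_near. Qed.

(** The quotient of [u ^+ 2 + s] is [(u s + u c)] times that of [u], plus 1; continuity of [u] gives
    the limit. *)
Lemma is_derive_within_sqrD {A u c l} :
  is_derive_within A u c l ->
  is_derive_within A (fun s => u s ^+ 2 + s) c (2 * u c * l + 1).
Proof.
move=> hl; have uc : u s @[s --> within A c^'] --> u c.
  apply: cvg_trans; last exact: is_derive_within_continuous hl.
  apply: cvg_app => B; rewrite /= /within => hB.
  exact: nbhs_dnbhs.
rewrite /is_derive_within.
have H : (u s + u c) * ((u s - u c) / (s - c)) + 1 @[s --> within A c^'] -->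
    2 * u c * l + 1.
  rewrite mulr_natl mulr2n; apply: cvgD; last exact: cvg_cst.
  by apply: cvgM => //; apply: cvgD => //; exact: cvg_cst.
apply: cvg_trans H.
apply: near_eq_cvg; rewrite near_withinE; near=> s => _.
have sc : s - c != 0 by rewrite subr_eq0; near: s; exact: nbhs_dnbhs_neq.
by rewrite /=; field.
Unshelve. all: by end_near. Qed.

(** One-sided Fermat rule: to the left of a maximum at the right end of an interval, numerator and
    denominator of the quotient are both nonpositive. *)
Lemma is_derive_within_left_max {A u a c l} : a < c ->
  `[a, c] `<=` A -> is_derive_within A u c l ->
  {in `[a, c], forall s, u s <= u c} -> 0 <= l.
Proof.
move=> ac sA hl uc.
have hq : (u s - u c) / (s - c) @[s --> c^'-] --> l.
  apply: cvg_trans; last exact: hl.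
  apply: cvg_app => B; rewrite /within/= => hB.
  near=> s; have [sc as_] : s < c /\ a < s.
    by split; near: s; [exact: nbhs_left_lt|exact: nbhs_left_gt].
  have As : A s by apply: sA; rewrite /= in_itv/= !ltW.
  have scN : s != c by rewrite lt_eqF.
  by move: scN As; near: s; apply: cvg_within; exact: hB.
rewrite -(cvg_lim _ hq)//; apply: limr_ge; first by apply/cvg_ex; exists l.
near=> s; rewrite mulr_le0// ?invr_le0 ?subr_le0.
  apply: uc; rewrite in_itv/=; apply/andP; split; near: s.
    exact: nbhs_left_ge.
  exact: nbhs_left_le.
by near: s; exact: nbhs_left_le.
Unshelve. all: by end_near. Qed.
End DeriveWithin.

(** The maximum over vertices need not be differentiable in time, so only the function of one vertex
    is differentiated, at a joint maximum over vertices and times. *)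
Lemma BE_Ricci_flow_max3_sqrD {R : realType} {T : \bar R} {m0 : 'I_3 -> R}
    {m : R -> 'I_3 -> R} {s t : R} :
  smooth_positive T m -> BE_Ricci_flow C3 T m0 m ->
  time_domain T s -> time_domain T t -> s <= t ->
  max3 (m t) ^+ 2 + t <= max3 (m s) ^+ 2 + s.
Proof.
move=> [mpos _] [flow _] [s0 _] [_ tT] st.
have stT r : r \in `[s, t] -> time_domain T r.
  rewrite in_itv/= => /andP[sr rt]; split; first exact: le_trans sr.
  by apply: le_lt_trans tT; rewrite lee_fin.
pose g i r := m r i ^+ 2 + r.
have gEVT i : exists2 c, c \in `[s, t] &
    forall r, r \in `[s, t] -> g i r <= g i c.
  apply: EVT_max => //.
  apply/subspace_continuousP => r rst.
  have [K _ dK] := flow r i (stT _ rst).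
  have := is_derive_within_continuous (is_derive_within_sqrD dK).
  apply: cvg_trans; apply: cvg_app.
  by apply: within_subset => v /stT.
have [c cst gc] := fin_all_exists2 gEVT.
have [i _ gi] := @arg_maxP _ _ _ ord0 predT (fun i => g i (c i)) isT.
have gmax j r : r \in `[s, t] -> g j r <= g i (c i).
  by move=> /gc/le_trans; apply; exact: gi.
have cT := stT _ (cst i).
have /andP[sc ct] : s <= c i <= t by have := cst i; rewrite in_itv.
have ci : c i = s.
  apply/eqP; rewrite eq_le sc andbT leNgt; apply/negP => {}sc.
  (* At equal times the summand [r] cancels, so a joint maximum of [g] is attained at a vertex of
     maximal weight. *)
  have mi j : m (c i) j <= m (c i) i.
    have := gmax j (c i) (cst i); rewrite lerD2r.
    by rewrite ler_sqr// nnegrE ltW// mpos.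
  have [K [_ Kmax] dK] := flow (c i) i cT.
  have mK : 1 <= m (c i) i * K.
    rewrite -ler_pdivrMl ?mpos// mulr1; apply: Kmax.
    by apply: curvature_ge_C3_argmax => // y; exact: mpos.
  (* Contradiction: [1 <= m * K] makes this derivative at most -1. *)
  have : 0 <= 2 * m (c i) i * - K + 1.
    apply: (is_derive_within_left_max sc _ (is_derive_within_sqrD dK)).
      move=> r /=; rewrite in_itv/= => /andP[sr rc]; apply: stT.
      by rewrite in_itv/= sr (le_trans rc).
    move=> r; rewrite in_itv/= => /andP[sr rc]; apply: gc.
    by rewrite in_itv/= sr (le_trans rc).
  by lra.
have [j ->] := max3_attained (m t).
have /le_trans : g j t <= g i (c i) by apply: gmax; rewrite in_itv/= st lexx.
apply; rewrite /g ci lerD2r ler_sqr ?le_max3// nnegrE; last first.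
  by apply: le_trans (le_max3 _ i); rewrite ltW// mpos// -ci.
by rewrite ltW// mpos// -ci.
Qed.

Theorem theorem3p4 (R : realType) (T : \bar R) (hT : (0%:E < T)%E)
    (m0 : 'I_3 -> R) (hm0 : forall x : 'I_3, 0 < m0 x)
    (m : R -> 'I_3 -> R) (hm : smooth_positive T m)
    (hflow : BE_Ricci_flow C3 T m0 m) :
  (forall s t : R, time_domain T s -> time_domain T t ->
     s < t -> max3 (m t) < max3 (m s)) /\
  (T <= (max3 (fun x => m0 x ^+ 2))%:E)%E.
Proof.
have pos t : time_domain T t -> 0 < max3 (m t).
  by move=> tT; apply: lt_le_trans (le_max3 _ ord0); exact: hm.1.
split=> [s t sT tT st|].
  have := BE_Ricci_flow_max3_sqrD hm hflow sT tT (ltW st).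
  (* Strictness comes from the time terms, as [s < t]. *)
  move=> H; have : max3 (m t) ^+ 2 < max3 (m s) ^+ 2 by lra.
  by rewrite ltr_sqr// nnegrE ltW// pos.
have M0 : 0 <= max3 (fun x => m0 x ^+ 2).
  by apply: le_trans (le_max3 _ ord0); exact: sqr_ge0.
rewrite leNgt; apply/negP => MT.
have T0 : time_domain T 0 by split.
(* If [T] exceeded [M], the maximum of [m0 ^+ 2], then time [M] would be admissible, and comparing
   times 0 and [M] would give [max3 (m M) ^+ 2 + M <= M], against positivity. *)
have TM : time_domain T (max3 (fun x => m0 x ^+ 2)) by split.
have := BE_Ricci_flow_max3_sqrD hm hflow T0 TM M0.
have [i ->] := max3_attained (m 0); rewrite hflow.2 addr0.
have := le_max3 (fun x => m0 x ^+ 2) i; have := exprn_gt0 2 (pos _ TM).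
by lra.
Qed.
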